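(* Let $T>0$, $\alpha\in(1/3,1/2]$, let $\mathbf{W}=(W,\mathbb{W})$ be an $\alpha$-Hölder rough path on $[0,T]$ with $W$ taking values in $\mathbb{R}^n$, and let $(y,y')\in\mathscr{D}^{2\alpha}_W(\mathcal{L}(\mathbb{R}^n,\mathbb{R}^d))$ be a controlled rough path. For all $s\le t$ in $[0,T]$, the sums $$\sum_{u,v\in\mathcal{P}} y_uW_{u,v}+y'_u\mathbb{W}_{u,v},$$ where $\mathcal{P}$ is a subdivision of $[s,t]$ and $u,v$ run over successive points of $\mathcal{P}$, converge as the mesh $|\mathcal{P}|$ tends to $0$; the limit exists and does not depend on the choice of the subdivisions. Denote it by $$\int_s^t y_u\,\mathrm{d}\mathbf{W}_u:=\lim_{|\mathcal{P}|\to0}\sum_{u,v\in\mathcal{P}}y_uW_{u,v}+y'_u\mathbb{W}_{u,v}.$$ Moreover, the map $(y,y')\mapsto\left(t\in[0,T]\mapsto\int_0^t y_u\,\mathrm{d}\mathbf{W}_u,\ y\right)$ is well defined and continuous from $\mathscr{D}^{2\alpha}_W(\mathcal{L}(\mathbb{R}^n,\mathbb{R}^d))$ into $\mathscr{D}^{2\alpha}_W(\mathbb{R}^d)$.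
   Context: For a path $Z$ write $Z_{s,t}:=Z_t-Z_s$, $\|Z\|_{\infty,T}=\sup_{t\in[0,T]}\|Z_t\|$ and $\|Z\|_{\alpha,T}=\sup_{s\ne t\in[0,T]}\|Z_{s,t}\|/|t-s|^\alpha$; for a two-parameter function $R$, $\|R\|_{2\alpha,T}=\sup_{s\neq t\in[0,T]}\|R_{s,t}\|/|t-s|^{2\alpha}$. An $\alpha$-Hölder rough path is a pair $(W,\mathbb{W})$, $W:[0,T]\to\mathbb{R}^n$, $\mathbb{W}:[0,T]^2\to\mathbb{R}^n\otimes\mathbb{R}^n$, with $\mathbb{W}_{s,t}-\mathbb{W}_{s,u}-\mathbb{W}_{u,t}=W_{s,u}\otimes W_{u,t}$ for all $s,u,t\in[0,T]$, $\|W\|_{\alpha,T}<\infty$ and $\|\mathbb{W}\|_{2\alpha,T}<\infty$. For a finite-dimensional normed space $E$, $\mathscr{D}^{2\alpha}_W(E)$ is the space of controlled rough paths: pairs $(y,y')$ of $\alpha$-Hölder functions $y:[0,T]\to E$, $y':[0,T]\to\mathcal{L}(\mathbb{R}^n,E)$ such that $y_{s,t}=y'_sW_{s,t}+R^y_{s,t}$ with $\|R^y\|_{2\alpha,T}<\infty$. It is a Banach space with the norm $\|y\|_{\infty,T}+\|y'\|_{\infty,T}+\|y'\|_{\alpha,T}+\|R^y\|_{2\alpha,T}$. For $E=\mathcal{L}(\mathbb{R}^n,\mathbb{R}^d)$, $y_uW_{u,v}$ is the evaluation of $y_u$ at $W_{u,v}$, and $y'_u\mathbb{W}_{u,v}:=\sum_{i,j=1}^n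 (y'_u e_i)(e_j)\,\mathbb{W}^{i,j}_{u,v}$, where $(e_i)$ is the canonical basis of $\mathbb{R}^n$. *)

(* Defs.v *)
From HB Require Import structures.
From mathcomp Require Import all_boot all_order all_algebra.
From mathcomp Require Import all_classical all_reals all_analysis.

Set Implicit Arguments.
Unset Strict Implicit.
Unset Printing Implicit Defensive.
Import Order.TTheory GRing.Theory Num.Theory.
Import numFieldNormedType.Exports.
Local Open Scope classical_set_scope.
Local Open Scope ring_scope.

(* Finite-dimensional normed spaces. R^n is 'cV[R]_n with the library norm, and
   L(R^n, E) is 'Hom('cV[R]_n, E) with the operator norm. *)
#[short(type="finNormedModType")]
HB.structure Definition FinNormedModule (K : numFieldType) :=
  {E of NormedModule K E & Vector K E}.

HB.instance Definition _ (K : numFieldType) m n :=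
  NormedModule.on 'M[K]_(m, n).

Section opnorm.
Context {R : realType} {n : nat} {E : finNormedModType R}.
Implicit Types f g : 'Hom('cV[R]_n, E).

Definition opnorm f : R :=
  sup [set `|f x| | x in [set x : 'cV[R]_n | `|x| <= 1]].

Lemma opnorm_has_sup f :
  has_sup [set `|f x| | x in [set x : 'cV[R]_n | `|x| <= 1]].
Proof.
split; first by exists `|f 0|; exists 0 => //=; rewrite normr0.
exists (\sum_(i < n) `|f (delta_mx i 0)|) => _ [x /= x1 <-].
have -> : x = \sum_(i < n) x i 0 *: delta_mx i 0.
  by rewrite [LHS]matrix_sum_delta; apply: eq_bigr => i _; rewrite big_ord1.
rewrite linear_sum (le_trans (ler_norm_sum _ _ _))//; apply: ler_sum => i _.
rewrite linearZ normrZ ler_piMl//; apply: le_trans x1.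
by rewrite [leRHS]/Num.norm/= mx_normrE (le_bigmax _ (fun ij => `|x ij.1 ij.2|) (i, 0)).
Qed.

Lemma opnorm_ub f (x : 'cV[R]_n) : `|x| <= 1 -> `|f x| <= opnorm f.
Proof. by move=> x1; apply: sup_upper_bound (opnorm_has_sup f) _ _; exists x. Qed.

Lemma opnorm_le f M :
  (forall x : 'cV[R]_n, `|x| <= 1 -> `|f x| <= M) -> opnorm f <= M.
Proof.
move=> H; apply: ge_sup; first by case: (opnorm_has_sup f).
by move=> _ [x x1 <-]; exact: H.
Qed.

Lemma opnormD f g : opnorm (f + g) <= opnorm f + opnorm g.
Proof.
apply: opnorm_le => x x1; rewrite lfunE/= (le_trans (ler_normD _ _))//.
by rewrite lerD// opnorm_ub.
Qed.

Lemma opnormZ l f : opnorm (l *: f) = `|l| * opnorm f.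
Proof.
have le k h : opnorm (k *: h) <= `|k| * opnorm h.
  apply: opnorm_le => x x1.
  by rewrite lfunE/= normrZ ler_wpM2l// opnorm_ub.
apply/eqP; rewrite eq_le le/=.
have [->|l0] := eqVneq l 0.
  by rewrite normr0 mul0r (le_trans _ (opnorm_ub _ (x := 0) _)) ?normr0.
rewrite mulrC -ler_pdivlMr ?normr_gt0// mulrC -normfV.
by rewrite (le_trans _ (le _ _))// scalerA mulVf// scale1r.
Qed.

Lemma opnorm_eq0 f : opnorm f = 0 -> f = 0.
Proof.
move=> f0; apply/lfunP => x; rewrite lfunE/=.
have [->|x0] := eqVneq x 0; first by rewrite linear0.
have : `|f (`|x|^-1 *: x)| <= 0.
  by rewrite -f0 opnorm_ub// normrZ normfV normr_id mulVf// normr_eq0.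
rewrite normr_le0 linearZ/= scaler_eq0 invr_eq0 normr_eq0 (negPf x0)/=.
by move/eqP.
Qed.

(* so that `|f| is the operator norm on 'Hom('cV_n, E) *)
HB.instance Definition _ := Lmodule_isNormed.Build R 'Hom('cV[R]_n, E)
  opnormD opnormZ opnorm_eq0.

End opnorm.

Section holder.
Context {R : realType} {E : normedModType R}.
Implicit Types (T gamma : R) (Z : R -> E) (A : R -> R -> E).

Definition incr Z (s t : R) : E := Z t - Z s.

Definition sup_norm T Z : \bar R :=
  ereal_sup [set `|Z t|%:E | t in `[0, T]].

Definition holder_norm2 gamma T A : \bar R :=
  ereal_sup [set (`|A p.1 p.2| / `|p.2 - p.1| `^ gamma)%:E |
    p in [set p : R * R | [/\ p.1 \in `[0, T], p.2 \in `[0, T] & p.1 != p.2]]].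

Definition holder_norm gamma T Z : \bar R := holder_norm2 gamma T (incr Z).

End holder.

Section rough_path.
Context {R : realType} {n : nat}.

Definition tensor (v w : 'cV[R]_n) : 'M[R]_n := v *m w^T.

Definition rough_path (alpha T : R) (W : R -> 'cV[R]_n)
    (WW : R -> R -> 'M[R]_n) : Prop :=
  [/\ forall s u t, s \in `[0, T] -> u \in `[0, T] -> t \in `[0, T] ->
        WW s t - WW s u - WW u t = tensor (incr W s u) (incr W u t),
      (holder_norm alpha T W < +oo)%E
    & (holder_norm2 (2 * alpha) T WW < +oo)%E].

End rough_path.

Section controlled.
Context {R : realType} {n : nat} {E : finNormedModType R}.
Variables (alpha T : R) (W : R -> 'cV[R]_n).

(* Pairs (y, y'). Paths are total functions on R, of which only the values on
   [0, T] matter. *)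
Definition path_pair : Type := (R -> E) * (R -> 'Hom('cV[R]_n, E)).
Implicit Type Y : path_pair.

Definition remainder Y (s t : R) : E := incr Y.1 s t - Y.2 s (incr W s t).

Definition controlled : set path_pair :=
  [set Y | [/\ (holder_norm alpha T Y.1 < +oo)%E,
               (holder_norm alpha T Y.2 < +oo)%E
             & (holder_norm2 (2 * alpha) T (remainder Y) < +oo)%E]].

Definition controlled_norm Y : \bar R :=
  (sup_norm T Y.1 + sup_norm T Y.2 + holder_norm alpha T Y.2
   + holder_norm2 (2 * alpha) T (remainder Y))%E.

End controlled.
Arguments path_pair {R} n E.

(* Continuity of Phi : D_W(E) -> D_W(F) for the topologies of the norms. *)
Definition controlled_continuous {R : realType} {n : nat}
    {E F : finNormedModType R} (alpha T : R) (W : R -> 'cV[R]_n)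
    (Phi : path_pair n E -> path_pair n F) : Prop :=
  forall Y : path_pair n E, controlled alpha T W Y -> forall e : R, 0 < e ->
  exists2 delta : R, 0 < delta &
    forall Z : path_pair n E, controlled alpha T W Z ->
      (controlled_norm alpha T W (Z - Y)%R < delta%:E)%E ->
      (controlled_norm alpha T W (Phi Z - Phi Y)%R < e%:E)%E.

Section subdivisions.
Context {R : realType}.
Implicit Types (s t delta : R) (p : seq R).

(* A subdivision s = t_0 < t_1 < ... < t_k = t of [s, t] is the sequence
   p = [:: t_1; ...; t_k] with itv_partition s t p. *)
Definition steps s p : seq (R * R) := zip (s :: p) p.

Definition mesh s p : R := \big[Num.max/0]_(uv <- steps s p) (uv.2 - uv.1).

Definition mesh0 s t : set_system (seq R) :=
  filter_from [set delta : R | 0 < delta]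
    (fun delta => [set p | itv_partition s t p /\ mesh s p < delta]).

Lemma mesh0_filter s t : Filter (mesh0 s t).
Proof.
apply: filter_from_filter; first by exists 1 => /=.
move=> i j /= i0 j0; exists (Num.min i j); first by rewrite /= lt_min i0.
by move=> p [ps]; rewrite lt_min => /andP[pi pj].
Qed.
#[global] Existing Instance mesh0_filter.

Lemma mesh0_proper s t : s <= t -> ProperFilter (mesh0 s t).
Proof.
move=> st; apply: filter_from_proper => delta /= delta0.
pose h := delta / 2; have h0 : 0 < h by rewrite divr_gt0.
have hd : h < delta by rewrite ltr_pdivrMr// mulr2n mulrDr mulr1 ltrDl.
suff H k : forall r, r <= t -> t - r <= h *+ k ->
    exists p, itv_partition r t p /\ mesh r p < delta.
  apply: (H (Num.truncn ((t - s) / h)).+1 s st).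
  by rewrite -mulr_natl -ler_pdivrMr// ltW// truncnS_gt.
elim: k => [|k IH] r rt tr.
  exists [::]; rewrite /mesh/= big_nil; split => //; split => //=.
  by rewrite eq_le rt/= -subr_le0.
have [hr|hr] := leP (t - r) h.
  have [-> |rt'] := eqVneq r t; first by exists [::]; rewrite /mesh/= big_nil; split.
  exists [:: t]; split; first by apply: itv_partition1; rewrite lt_neqAle rt'.
  by rewrite /mesh big_cons big_nil/= gt_max delta0 andbT (le_lt_trans hr).
have [||p [[pp pl] pm]] := IH (r + h).
- by rewrite addrC -lerBrDr ltW.
- by rewrite opprD addrA lerBlDr -mulrSr.
exists ((r + h) :: p); split; first by split => //=; rewrite ltrDl h0.
by rewrite /mesh big_cons/= gt_max -/(mesh _ p) pm addrAC subrr add0r hd.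
Qed.

End subdivisions.

Section rough_integral.
Context {R : realType} {n d : nat}.
Variables (W : R -> 'cV[R]_n) (WW : R -> R -> 'M[R]_n).
Implicit Types (Y : path_pair n 'Hom('cV[R]_n, 'cV[R]_d)) (s t u v : R).

Definition rough_germ Y u v : 'cV[R]_d :=
  Y.1 u (incr W u v) +
  \sum_(i < n) \sum_(j < n)
    WW u v i j *: Y.2 u (delta_mx i 0) (delta_mx j 0).

Definition rough_sum Y s (p : seq R) : 'cV[R]_d :=
  \sum_(uv <- steps s p) rough_germ Y uv.1 uv.2.

Definition rough_integral Y s t : 'cV[R]_d :=
  lim (rough_sum Y s p @[p --> mesh0 s t]).

Definition rough_integral_map Y : path_pair n 'cV[R]_d :=
  (fun t => rough_integral Y 0 t, Y.1).

End rough_integral.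

(* Main.v *)
Require Import Defs.
From HB Require Import structures.
From mathcomp Require Import all_boot all_order all_algebra.
From mathcomp Require Import all_classical all_reals all_analysis.
From mathcomp Require Import ring lra.

Set Implicit Arguments.
Unset Strict Implicit.
Unset Printing Implicit Defensive.

Import Order.TTheory GRing.Theory Num.Theory.
Import numFieldNormedType.Exports.
Local Open Scope classical_set_scope.
Local Open Scope ring_scope.

(** The compensated sums are Riemann-type sums of the two-parameter germ
    Xi(u,v) = y_u W_{u,v} + y'_u WW_{u,v}. Chen's relation and the expansion
    of y make this germ almost additive: for s <= u <= t its defect is
      Xi(s,t) - Xi(s,u) - Xi(u,t) = - R_{s,u} W_{u,t} - y'_{s,u} WW_{u,t},
    of size O(|t-s|^{3 alpha}) with 3 alpha > 1 (rough_germ_defect,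
    rough_germ_almost_additive). Everything then follows from a sewing lemma
    for a germ whose defect is at most K |t-s|^theta with theta > 1.

    The sewing lemma rests on a bound that is uniform over subdivisions: the
    sum over any subdivision of [s,t] differs from Xi(s,t) by at most
    C |t-s|^theta (sewing_inequality). It is proved by bisection: cutting at
    the interval that contains the midpoint leaves two subdivisions of
    intervals of length at most |t-s|/2, so that C must satisfy
    2 C 2^{-theta} + 2 K <= C, which has a solution exactly because theta > 1.
    Applied on each interval of a subdivision, it shows that refining a
    subdivision of mesh delta moves the sum by at most
    C |t-s| delta^{theta-1}. Through a common refinement, the sums are Cauchy
    as the mesh tends to 0; the limit inherits the local bound
    (sewing_local) and is additive over adjacent intervals
    (sewing_additive).

    Hence the increments of t |-> int_0^t y dW are
    y_s W_{s,t} + y'_s WW_{s,t} + O(|t-s|^{3 alpha}), which says that y is a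
    derivative of the integral with remainder of order 2 alpha. All constants
    are proportional to the size of (y,y') (rough_integral_bound), and the
    integral is linear in (y,y') (rough_integralB): a bounded linear map is
    continuous. *)

(** * Subdivisions of an interval *)

Section subdivision_lemmas.
Context {R : realType}.
Implicit Types (r s t x : R) (p q : seq R).

Lemma itv_partition_catP s t x p q :
  itv_partition s t (p ++ x :: q) <->
  [/\ itv_partition s (last s p) p, last s p < x & itv_partition x t q].
Proof.
rewrite /itv_partition cat_path last_cat /= eqxx; split.
  by move=> [/and3P[-> -> ->] ->].
by move=> [[-> _] -> [-> ->]].
Qed.

Lemma itv_partition_rcons s x p :
  itv_partition s (last s p) p -> last s p < x ->
  itv_partition s x (rcons p x).
Proof.
by move=> [ps _] px; split; rewrite ?last_rcons// rcons_path ps.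
Qed.

Lemma itv_partition_mem s t p x :
  itv_partition s t p -> x \in p -> s < x <= t.
Proof.
move=> + /splitPr xp; case: xp => p1 p2 /itv_partition_catP[p1s p1x p2t].
by rewrite (le_lt_trans (itv_partition_le p1s) p1x) (itv_partition_le p2t).
Qed.

(** Some interval of the subdivision contains any given point r: this is where
    the bisection cuts. *)
Lemma itv_partition_straddle s t p r :
  itv_partition s t p -> p != [::] -> s <= r <= t ->
  exists p1 x p2, p = p1 ++ x :: p2 /\ last s p1 <= r <= x.
Proof.
elim: p s => // x p IH s [/= /andP[sx xp] xt] _ /andP[sr rt].
have [rx|xr] := leP r x; first by exists [::], x, p; rewrite /= sr.
have [p0|p0] := eqVneq p [::].
  by move: xr; rewrite p0/= in xt; rewrite ltNge (eqP xt) rt.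
have [//|//||p1 [y [p2 [-> ry]]]] := IH x; first by rewrite ltW.
by exists (x :: p1), y, p2.
Qed.

Lemma itv_partition_refinement s t p q :
  itv_partition s t p -> itv_partition s t q ->
  exists2 r, itv_partition s t r & {subset p <= r} /\ {subset q <= r}.
Proof.
move=> pst qst; have [st|st] := eqVneq s t.
  rewrite -st in pst qst *.
  by rewrite (itv_partitionxx pst) (itv_partitionxx qst); exists [::].
have tq : t \in q.
  have [_ /eqP] := qst; have := mem_last s q; rewrite inE.
  by move=> /orP[/eqP -> qt|+ <-//]; rewrite qt eqxx in st.
(* The merged points; t is the largest of them, hence the last. *)
pose r := sort <=%O (undup (p ++ q)).
have rE x : (x \in r) = (x \in p) || (x \in q).
  by rewrite mem_sort mem_undup mem_cat.
have r_itv x : x \in r -> s < x <= t.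
  by rewrite rE => /orP[]; exact: itv_partition_mem.
have path_r : path <%O s r.
  rewrite lt_path_sortedE sort_lt_sorted undup_uniq andbT.
  by apply/allP => x /r_itv/andP[].
exists r; last by split=> x xp; rewrite rE xp ?orbT.
split => //; have tr : t \in r by rewrite rE tq orbT.
have : last s r \in r by case: (r) tr => // a l _; rewrite /= mem_last.
move=> /r_itv/andP[_ rt]; rewrite eq_le rt/=.
move: path_r; case/splitPr : tr => r1 r2; rewrite cat_path last_cat/=.
move=> /and3P[_ _ tr2]; suff : itv_partition t (last t r2) r2.
  exact: itv_partition_le.
by split.
Qed.

Lemma mesh_cons s x p : mesh s (x :: p) = Num.max (x - s) (mesh x p).
Proof. by rewrite /mesh /= big_cons. Qed.

Lemma mesh_nil s : mesh s [::] = 0.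
Proof. by rewrite /mesh /= big_nil. Qed.

Lemma mesh_ge0 s p : 0 <= mesh s p.
Proof. exact: bigmax_ge_id. Qed.

Lemma mesh_cat s p q : mesh s (p ++ q) = Num.max (mesh s p) (mesh (last s p) q).
Proof.
elim: p s => [|x p IH] s; first by rewrite mesh_nil max_r// mesh_ge0.
by rewrite /= !mesh_cons IH maxA.
Qed.

End subdivision_lemmas.

Section germ_sum.
Context {R : realType} {E : zmodType}.
Implicit Types (Xi : R -> R -> E) (s t : R) (p q : seq R).

Definition germ_sum Xi s p : E := \sum_(uv <- steps s p) Xi uv.1 uv.2.

Lemma germ_sum_nil Xi s : germ_sum Xi s [::] = 0.
Proof. by rewrite /germ_sum big_nil. Qed.

Lemma germ_sum_cons Xi s t p :
  germ_sum Xi s (t :: p) = Xi s t + germ_sum Xi t p.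
Proof. by rewrite /germ_sum /= big_cons. Qed.

Lemma germ_sum_cat Xi s p q :
  germ_sum Xi s (p ++ q) = germ_sum Xi s p + germ_sum Xi (last s p) q.
Proof.
elim: p s => [|x p IH] s; first by rewrite germ_sum_nil add0r.
by rewrite /= !germ_sum_cons IH addrA.
Qed.

End germ_sum.
(** * Powers and the sewing constant *)

Section powR_lemmas.
Context {R : realType}.
Implicit Types (x y theta : R).

Lemma ler_powR2r theta x y :
  0 <= theta -> 0 <= x -> x <= y -> x `^ theta <= y `^ theta.
Proof.
by move=> theta0 x0 xy; apply: ge0_ler_powR; rewrite // nnegrE// (le_trans x0).
Qed.

Lemma ler_powR_split (x y L : R) : 0 <= x -> x <= L -> 0 <= y -> y <= L ->
  forall a b : R, 0 < a -> 0 < b -> x `^ a * y `^ b <= L `^ (a + b).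
Proof.
move=> x0 xL y0 yL a b a0 b0; rewrite powRD; last first.
  by rewrite gt_eqF// addr_gt0.
by rewrite ler_pM ?powR_ge0// ler_powR2r// ltW.
Qed.

(** The contraction factor of one bisection step: two halves, each contributing
    2^-theta of the bound for the whole. *)
Lemma bisection_ratio_lt1 theta : 1 < theta -> 2 * 2^-1 `^ theta < 1 :> R.
Proof.
move=> theta1; rewrite -(@mulr_powRB1 _ 2^-1 theta); [|by []|by lra].
rewrite mulrA divff// mul1r.
rewrite [ltRHS](_ : 1 = 1 `^ (theta - 1)); last by rewrite powR1.
by apply: gt0_ltr_powR; rewrite ?nnegrE ?subr_gt0//; lra.
Qed.

(** The solution c of 2 c 2^-theta + 2 = c: the two halves of a bisection cost
    2 c 2^-theta, and gluing them costs two defects. *)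
Definition sewing_const theta : R := 2 / (1 - 2 * 2^-1 `^ theta).

Lemma sewing_const_ge0 theta : 1 < theta -> 0 <= sewing_const theta.
Proof. by move=> /bisection_ratio_lt1 ?; rewrite divr_ge0// subr_ge0 ltW. Qed.

Lemma sewing_constE theta : 1 < theta ->
  sewing_const theta * (2 * 2^-1 `^ theta) + 2 = sewing_const theta.
Proof. by move=> /bisection_ratio_lt1 ?; rewrite /sewing_const; field; lra. Qed.

Lemma powR_small_step (k theta : R) : 0 < theta -> 0 <= k -> forall e, 0 < e ->
  exists2 delta, 0 < delta & k * delta `^ theta < e.
Proof.
move=> theta0 k0 e e0; exists ((e / (k + 1)) `^ theta^-1).
  by rewrite powR_gt0// divr_gt0//; lra.
rewrite -powRrM mulVf ?gt_eqF// powRr1 ?divr_ge0//; [|lra|lra].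
by rewrite mulrA ltr_pdivrMr; nra.
Qed.

End powR_lemmas.

(** * The sewing lemma *)

Section sewing.
Context {R : realType} {E : completeNormedModType R}.
Variables (a b theta K : R) (Xi : R -> R -> E).
Hypotheses (theta_gt1 : 1 < theta) (K_ge0 : 0 <= K).
Hypothesis almost_additive : forall s u t,
  a <= s -> s <= u -> u <= t -> t <= b ->
  `|Xi s t - (Xi s u + Xi u t)| <= K * (t - s) `^ theta.
Implicit Types (s t u delta : R) (p q : seq R).

Local Notation C := (K * sewing_const theta).

Let C_ge0 : 0 <= C.
Proof. by rewrite mulr_ge0// sewing_const_ge0. Qed.

Let theta_ge0 : 0 <= theta.
Proof. by rewrite ltW// (lt_trans ltr01). Qed.

Let ler_dist_add (x y x' y' : E) :
  `|x + y - (x' + y')| <= `|x - x'| + `|y - y'|.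
Proof. by rewrite opprD addrACA ler_normD. Qed.

Lemma sewing_diag s : a <= s -> s <= b -> Xi s s = 0.
Proof.
move=> sa sb; have := almost_additive sa (lexx s) (lexx s) sb.
rewrite opprD addrA subrr sub0r normrN (subrr s) powR0 ?mulr0 ?normr_le0.
  by move/eqP.
by rewrite gt_eqF// (lt_trans ltr01).
Qed.

(** Cut at the interval [u,v] that contains the midpoint of [s,t]. The
    subdivisions left on [s,u] and [v,t] are shorter and live on intervals of
    at most half the length, so induction applies to both; gluing
    Xi(s,u) + Xi(u,v) + Xi(v,t) back into Xi(s,t) costs two defects, and the
    constant is tuned to reproduce itself. No information on the mesh enters. *)
Lemma sewing_inequality s t p : a <= s -> t <= b -> itv_partition s t p ->
  `|germ_sum Xi s p - Xi s t| <= C * (t - s) `^ theta.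
Proof.
have [n] := ubnP (size p); elim: n s t p => // n IH s t p.
rewrite ltnS => pn sa tb pst; have st := itv_partition_le pst.
have [p0|p0] := eqVneq p [::].
  move: pst; rewrite p0 => /itv_partition_nil ->; rewrite germ_sum_nil.
  by rewrite sewing_diag ?(le_trans sa st)// subrr normr0 mulr_ge0// powR_ge0.
have [|p1 [v [p2 [pE /andP[um mv]]]]] :=
  itv_partition_straddle (r := (s + t) / 2) pst p0.
  by lra.
move: pst pn; rewrite {}pE => /itv_partition_catP[].
set u := last s p1 in um * => p1su uv p2vt pn.
have su := itv_partition_le p1su; have vt := itv_partition_le p2vt.
have [p1n p2n] : (size p1 < n)%N /\ (size p2 < n)%N.
  rewrite size_cat /= addnS in pn.
  by split; apply: leq_ltn_trans pn; rewrite ?leq_addr ?leq_addl.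
have IH1 : `|germ_sum Xi s p1 - Xi s u| <= C * ((t - s) / 2) `^ theta.
  rewrite (le_trans (IH s u p1 _ _ _ _))//; first by lra.
  by rewrite ler_wpM2l// ler_powR2r//; lra.
have IH2 : `|germ_sum Xi v p2 - Xi v t| <= C * ((t - s) / 2) `^ theta.
  rewrite (le_trans (IH v t p2 _ _ _ _))//; first by lra.
  by rewrite ler_wpM2l// ler_powR2r//; lra.
have Xsut : `|Xi s u + Xi u t - Xi s t| <= K * (t - s) `^ theta.
  by rewrite distrC almost_additive//; lra.
have Xuvt : `|Xi u v + Xi v t - Xi u t| <= K * (t - s) `^ theta.
  rewrite distrC (le_trans (almost_additive _ _ _ _))//; try by lra.
  by rewrite ler_wpM2l// ler_powR2r//; lra.
rewrite germ_sum_cat germ_sum_cons -/u.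
apply: le_trans (ler_distD (Xi s u + (Xi u v + Xi v t)) _ _) _.
have := ler_dist_add (germ_sum Xi s p1) (Xi u v + germ_sum Xi v p2)
  (Xi s u) (Xi u v + Xi v t).
have := ler_dist_add (Xi u v) (germ_sum Xi v p2) (Xi u v) (Xi v t).
have := ler_distD (Xi s u + Xi u t) (Xi s u + (Xi u v + Xi v t)) (Xi s t).
have := ler_dist_add (Xi s u) (Xi u v + Xi v t) (Xi s u) (Xi u t).
rewrite !subrr !normr0 !add0r.
move: Xsut Xuvt IH1 IH2; rewrite powRM ?invr_ge0 ?subr_ge0//.
have := sewing_constE theta_gt1; set c := sewing_const _.
set q := 2^-1 `^ theta; set L := (t - s) `^ theta => cq.
have -> : K * c * L = K * c * (L * q) + K * c * (L * q) + K * L + K * L.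
  by rewrite -[in LHS]cq; ring.
by lra.
Qed.

(** A refinement q of p restricts to a subdivision of each interval of p, on
    which the previous inequality applies; a step of length h <= delta costs
    C h^theta <= C h delta^(theta-1), and the h add up to t - s. *)
Lemma sewing_refinement s t p q delta : a <= s -> t <= b ->
  itv_partition s t p -> itv_partition s t q -> {subset p <= q} ->
  mesh s p <= delta ->
  `|germ_sum Xi s q - germ_sum Xi s p| <= C * (t - s) * delta `^ (theta - 1).
Proof.
elim: p s q => [|x p IH] s q sa tb.
  move=> /itv_partition_nil -> /itv_partitionxx -> _ _.
  by rewrite subrr normr0 subrr mulr0 mul0r.
move=> xpst qst xpq; rewrite mesh_cons ge_max => /andP[xs pdelta].
have xq : x \in q by rewrite xpq// mem_head.
have [/= /andP[sx] xp pt] := xpst.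
have {xp pt} xpt : itv_partition x t p by [].
case/splitPr : xq qst xpq => q1 q2 /itv_partition_catP[q1s q1x q2t] xpq.
have pq2 : {subset p <= q2}.
  move=> z zp; have /andP[xz _] := itv_partition_mem xpt zp.
  have := xpq z; rewrite inE zp orbT mem_cat inE => /(_ isT)/or3P[|/eqP zx|//].
  - move=> /(itv_partition_mem q1s)/andP[_ zl].
    by have := lt_trans xz (le_lt_trans zl q1x); rewrite ltxx.
  - by rewrite zx ltxx in xz.
have {}sx : s < x by [].
have xt := itv_partition_le xpt.
have q1E : itv_partition s x (rcons q1 x) by exact: itv_partition_rcons.
rewrite -cat_rcons germ_sum_cat last_rcons germ_sum_cons.
apply: le_trans (ler_dist_add _ _ _ _) _.
have IH1 : `|germ_sum Xi x q2 - germ_sum Xi x p| <=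
    C * (t - x) * delta `^ (theta - 1) by apply: IH => //; lra.
have IH2 : `|germ_sum Xi s (rcons q1 x) - Xi s x| <=
    C * (x - s) * delta `^ (theta - 1).
  rewrite (le_trans (sewing_inequality _ _ q1E))//; first by lra.
  rewrite -[leRHS]mulrA ler_wpM2l// -(@mulr_powRB1 _ (x - s) theta)
    ?subr_ge0 ?(ltW sx)//;
    last exact: lt_trans ltr01 theta_gt1.
  apply: ler_wpM2l; first by rewrite subr_ge0 ltW.
  by rewrite ler_powR2r// subr_ge0 ltW.
rewrite (le_trans (lerD IH2 IH1))// -mulrDl -mulrDr.
by rewrite addrC addrA subrK.
Qed.

Lemma sewing_mesh s t p q delta : a <= s -> t <= b ->
  itv_partition s t p -> itv_partition s t q ->
  mesh s p <= delta -> mesh s q <= delta ->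
  `|germ_sum Xi s p - germ_sum Xi s q| <=
    2 * C * (t - s) * delta `^ (theta - 1).
Proof.
move=> sa tb pst qst pd qd.
have [r rst [pr qr]] := itv_partition_refinement pst qst.
have := sewing_refinement sa tb pst rst pr pd.
have := sewing_refinement sa tb qst rst qr qd.
have := ler_distD (germ_sum Xi s r) (germ_sum Xi s p) (germ_sum Xi s q).
by rewrite (distrC (germ_sum Xi s p) (germ_sum Xi s r)); lra.
Qed.

Lemma cvg_sewing s t : a <= s -> s <= t -> t <= b ->
  cvg (germ_sum Xi s p @[p --> mesh0 s t]).
Proof.
move=> sa st tb; have FF := mesh0_proper st.
apply: cauchy_cvg; apply: cauchy_exP => e e0.
have k0 : 0 <= 2 * C * (t - s) by rewrite mulr_ge0 ?subr_ge0// mulr_ge0.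
have [|delta delta0 small] := powR_small_step (theta := theta - 1) _ k0 e0.
  by rewrite subr_gt0.
have mdelta : mesh0 s t [set p | itv_partition s t p /\ mesh s p < delta].
  by exists delta.
have [p0 [p0st p0d]] := filter_ex mdelta.
exists (germ_sum Xi s p0); apply: filterS mdelta => p [pst pd].
rewrite -ball_normE /ball_/= (le_lt_trans _ small)//.
by apply: sewing_mesh => //; exact: ltW.
Qed.

(** The additive function that the germ approximates. *)
Definition sewing s t : E := lim (germ_sum Xi s p @[p --> mesh0 s t]).

Lemma sewing_approx s t e : a <= s -> s <= t -> t <= b -> 0 < e ->
  exists2 delta, 0 < delta & forall p, itv_partition s t p ->
    mesh s p < delta -> `|sewing s t - germ_sum Xi s p| < e.
Proof.
move=> sa st tb e0; have /cvgrPdist_lt/(_ _ e0) := cvg_sewing sa st tb.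
by move=> [delta delta0 H]; exists delta => // p pst pd; apply: H.
Qed.

Lemma sewing_local s t : a <= s -> s <= t -> t <= b ->
  `|sewing s t - Xi s t| <= C * (t - s) `^ theta.
Proof.
move=> sa st tb; apply/ler_addgt0Pr => e e0.
have [delta delta0 H] := sewing_approx sa st tb e0.
have FF := mesh0_proper st.
have [p [pst pd]] : exists p, itv_partition s t p /\ mesh s p < delta.
  by apply: (@filter_ex _ (mesh0 s t)); exists delta.
have := H p pst pd; have := sewing_inequality sa tb pst.
by have := ler_distD (germ_sum Xi s p) (sewing s t) (Xi s t); lra.
Qed.

(** Concatenating fine subdivisions of [s,u] and [u,t] gives a fine subdivision
    of [s,t]. *)
Lemma sewing_additive s u t : a <= s -> s <= u -> u <= t -> t <= b ->
  sewing s t = sewing s u + sewing u t.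
Proof.
move=> sa su ut tb.
apply/eqP; rewrite -subr_eq0 -normr_le0; apply/ler_addgt0Pr => e e0.
have e3 : 0 < e / 3 by lra.
have [|||delta1 delta10 H1] :=
  sewing_approx (s := s) (t := u) _ _ _ e3; try by lra.
have [|||delta2 delta20 H2] :=
  sewing_approx (s := u) (t := t) _ _ _ e3; try by lra.
have [|||delta delta0 H] :=
  sewing_approx (s := s) (t := t) _ _ _ e3; try by lra.
have fine_subdivision x y eta : x <= y -> 0 < eta ->
    exists p, itv_partition x y p /\ mesh x p < eta.
  move=> xy eta0; have FF := mesh0_proper xy.
  by apply: (@filter_ex _ (mesh0 x y)); exists eta.
have [||p [psu]] := fine_subdivision s u (Num.min delta delta1) => //.
  by rewrite lt_min delta0.
rewrite lt_min => /andP[pd pd1].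
have [||q [qut]] := fine_subdivision u t (Num.min delta delta2) => //.
  by rewrite lt_min delta0.
rewrite lt_min => /andP[qd qd2].
have lastp : last s p = u by case: psu => _ /eqP.
have := H _ (itv_partition_cat psu qut).
rewrite mesh_cat lastp gt_max pd qd => /(_ isT).
have := H1 _ psu pd1; have := H2 _ qut qd2; rewrite germ_sum_cat lastp.
have := ler_distD (germ_sum Xi s p + germ_sum Xi u q) (sewing s t)
  (sewing s u + sewing u t).
have := ler_dist_add (germ_sum Xi s p) (germ_sum Xi u q)
  (sewing s u) (sewing u t).
rewrite (distrC (germ_sum Xi s p)) (distrC (germ_sum Xi u q)).
by lra.
Qed.

End sewing.
(** * Norms as pointwise bounds *)

Section holder_bounds.
Context {R : realType} {E : normedModType R}.
Implicit Types (T gamma c : R) (Z : R -> E) (A : R -> R -> E).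

Lemma sup_norm_leP T Z c :
  (sup_norm T Z <= c%:E)%E <-> (forall t, 0 <= t <= T -> `|Z t| <= c).
Proof.
split=> [H t tT|H].
  rewrite -lee_fin (le_trans _ H)//; apply: ereal_sup_ubound.
  by exists t; rewrite //= in_itv.
apply: ge_ereal_sup => _ [t /= tT <-]; rewrite lee_fin H//.
Qed.

Lemma holder_norm2_leP gamma T A c :
  (holder_norm2 gamma T A <= c%:E)%E <->
  (forall s t, 0 <= s <= T -> 0 <= t <= T -> s != t ->
    `|A s t| <= c * `|t - s| `^ gamma).
Proof.
split=> [H s t sT tT st|H].
  have ts : 0 < `|t - s| by rewrite normr_gt0 subr_eq0 eq_sym.
  rewrite -ler_pdivrMr ?powR_gt0// -lee_fin (le_trans _ H)//.
  by apply: ereal_sup_ubound; exists (s, t) => //; split; rewrite /= ?in_itv.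
apply: ge_ereal_sup => _ [[s t] /= [sT tT st] <-].
have ts : 0 < `|t - s| by rewrite normr_gt0 subr_eq0 eq_sym.
rewrite lee_fin ler_pdivrMr ?powR_gt0// H//.
Qed.

Lemma sup_norm_ge0 T Z : 0 < T -> (0 <= sup_norm T Z)%E.
Proof.
move=> T0; apply: le_ereal_sup_tmp; exists `|Z 0|%:E; last by rewrite lee_fin.
by exists 0 => //; rewrite /= ?in_itv/= lexx ltW.
Qed.

Lemma holder_norm2_ge0 gamma T A : 0 < T -> (0 <= holder_norm2 gamma T A)%E.
Proof.
move=> T0; apply: le_ereal_sup_tmp.
exists (`|A 0 T| / `|T - 0| `^ gamma)%:E.
  exists (0, T) => //; split; rewrite /= ?in_itv/= ?lexx ?ltW//.
  by rewrite eq_sym gt_eqF.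
by rewrite lee_fin divr_ge0// powR_ge0.
Qed.

Lemma holder_norm2_lty gamma T A : (holder_norm2 gamma T A < +oo)%E ->
  exists2 c, 0 <= c & forall s t, 0 <= s <= T -> 0 <= t <= T -> s != t ->
    `|A s t| <= c * `|t - s| `^ gamma.
Proof.
move=> H; exists (Num.max 0 (fine (holder_norm2 gamma T A))).
  by rewrite le_max lexx.
apply/holder_norm2_leP; move: H; case: holder_norm2 => [r _| |_] //=.
  by rewrite lee_fin le_max lexx orbT.
by rewrite leNye.
Qed.

End holder_bounds.

Section opnorm_bound.
Context {R : realType} {n : nat} {E : finNormedModType R}.

Lemma ler_hom_norm (f : 'Hom('cV[R]_n, E)) (x : 'cV[R]_n) :
  `|f x| <= `|f| * `|x|.
Proof.
have [->|x0] := eqVneq x 0; first by rewrite linear0 !normr0 mulr0.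
rewrite -ler_pdivrMr ?normr_gt0// mulrC -[X in X * _]ger0_norm ?invr_ge0//.
rewrite -normrZ -linearZ opnorm_ub// normrZ normfV normr_id mulVf//.
by rewrite normr_eq0.
Qed.

End opnorm_bound.

(** * Bilinear maps evaluated on tensors *)

Section contraction.
Context {R : realType} {n d : nat}.
Implicit Types (A B : 'Hom('cV[R]_n, 'Hom('cV[R]_n, 'cV[R]_d))) (M N : 'M[R]_n).

(** The bilinear form A extended linearly to the tensor square of R^n, with
    tensors encoded as matrices. *)
Definition tensor_eval A M : 'cV[R]_d :=
  \sum_(i < n) \sum_(j < n) M i j *: A (delta_mx i 0) (delta_mx j 0).

Lemma tensor_evalDr A M N :
  tensor_eval A (M + N) = tensor_eval A M + tensor_eval A N.
Proof.
rewrite -big_split; apply: eq_bigr => i _; rewrite -big_split.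
by apply: eq_bigr => j _; rewrite mxE scalerDl.
Qed.

Lemma tensor_evalDl A B M :
  tensor_eval (A + B) M = tensor_eval A M + tensor_eval B M.
Proof.
rewrite -big_split; apply: eq_bigr => i _; rewrite -big_split.
by apply: eq_bigr => j _; rewrite !add_lfunE scalerDr.
Qed.

Lemma tensor_evalNl A M : tensor_eval (- A) M = - tensor_eval A M.
Proof.
rewrite -sumrN; apply: eq_bigr => i _; rewrite -sumrN.
by apply: eq_bigr => j _; rewrite !opp_lfunE scalerN.
Qed.

Lemma tensor_eval_tensor A (v w : 'cV[R]_n) :
  tensor_eval A (tensor v w) = A v w.
Proof.
have cVE (x : 'cV[R]_n) : x = \sum_(i < n) x i 0 *: delta_mx i 0.
  by rewrite [LHS]matrix_sum_delta; apply: eq_bigr => i _; rewrite big_ord1.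
rewrite [in RHS](cVE v) linear_sum sum_lfunE; apply: eq_bigr => i _.
rewrite [in RHS](cVE w) linear_sum; apply: eq_bigr => j _.
by rewrite linearZ/= linearZ/= lfunE/= scalerA !mxE big_ord1 mxE mulrC.
Qed.

Lemma ler_tensor_eval A M : `|tensor_eval A M| <= (n ^ 2)%:R * `|A| * `|M|.
Proof.
have delta1 (i : 'I_n) : `|delta_mx i 0 : 'cV[R]_n| <= 1.
  rewrite [leLHS]/Num.norm/= mx_normrE; apply: bigmax_le => // ij _.
  by rewrite mxE; case: andb; rewrite ?normr1 ?normr0.
have entry i j : `|M i j *: A (delta_mx i 0) (delta_mx j 0)| <= `|M| * `|A|.
  rewrite normrZ ler_pM//.
    by rewrite [leRHS]/Num.norm/= mx_normrE
      (le_bigmax _ (fun ij => `|M ij.1 ij.2|) (i, j)).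
  rewrite (le_trans (ler_hom_norm _ _))// (le_trans (ler_piMr _ _))//.
  by rewrite (le_trans (ler_hom_norm _ _))// ler_piMr.
rewrite (le_trans (ler_norm_sum _ _ _))//.
apply: (@le_trans _ _ (\sum_(i < n) \sum_(j < n) `|M| * `|A|)).
  apply: ler_sum => i _; rewrite (le_trans (ler_norm_sum _ _ _))//.
  exact: ler_sum.
rewrite !sumr_const !card_ord; rewrite le_eqVlt; apply/predU1P; left.
by ring.
Qed.

End contraction.

(** * Controlled paths with explicit bounds *)

Section controlled_bound.
Context {R : realType} {n : nat}.
Variables (T alpha w : R) (W : R -> 'cV[R]_n).
Hypotheses (T_gt0 : 0 < T) (alpha_gt0 : 0 < alpha).
Hypothesis W_holder : forall s t, 0 <= s <= T -> 0 <= t <= T ->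
  `|incr W s t| <= w * `|t - s| `^ alpha.

Section fixed_space.
Context {E : finNormedModType R}.
Implicit Types (Y Z : path_pair n E) (c : R).

(** Up to the factor 4, c bounds the norm of Y. Working with one real number
    instead of a sum of extended suprema keeps the estimates in R, and makes
    their linearity in Y visible. *)
Definition controlled_bound Y c : Prop :=
  [/\ forall t, 0 <= t <= T -> `|Y.1 t| <= c,
      forall t, 0 <= t <= T -> `|Y.2 t| <= c,
      forall s t, 0 <= s <= T -> 0 <= t <= T ->
        `|incr Y.2 s t| <= c * `|t - s| `^ alpha
    & forall s t, 0 <= s <= T -> 0 <= t <= T ->
        `|remainder W Y s t| <= c * `|t - s| `^ (2 * alpha)].

Lemma controlled_bound_ge0 Y c : controlled_bound Y c -> 0 <= c.
Proof. by move=> [Y1c _ _ _]; rewrite (le_trans _ (Y1c 0 _))// lexx ltW. Qed.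

Lemma controlled_bound_eq Y Z c :
  (forall t, 0 <= t <= T -> Y.1 t = Z.1 t /\ Y.2 t = Z.2 t) ->
  controlled_bound Y c -> controlled_bound Z c.
Proof.
move=> YZ [Y1c Y2c Y2h Yr]; split=> [t tT|t tT|s t sT tT|s t sT tT].
- by rewrite -(YZ t tT).1 Y1c.
- by rewrite -(YZ t tT).2 Y2c.
- by rewrite /incr -(YZ t tT).2 -(YZ s sT).2 Y2h.
- rewrite /remainder {1}/incr -(YZ t tT).1 -(YZ s sT).1 -(YZ s sT).2.
  exact: Yr.
Qed.

Lemma dist_time_le s t : 0 <= s <= T -> 0 <= t <= T -> `|t - s| <= T.
Proof. by move=> sT tT; rewrite ler_norml; lra. Qed.

Lemma powR_time_le theta s t : 0 <= theta -> 0 <= s <= T -> 0 <= t <= T ->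
  `|t - s| `^ theta <= T `^ theta.
Proof. by move=> theta0 sT tT; rewrite ler_powR2r// dist_time_le. Qed.

Lemma powR_double_alpha (x : R) : x `^ (2 * alpha) = x `^ alpha * x `^ alpha.
Proof.
rewrite -powRD; last by rewrite gt_eqF// addr_gt0.
by congr (_ `^ _); ring.
Qed.

Lemma incr_remainder Y s t :
  incr Y.1 s t = Y.2 s (incr W s t) + remainder W Y s t.
Proof. by rewrite /remainder addrC subrK. Qed.

(** The norm does not contain the Hölder norm of the path itself: it is
    recovered from the expansion y_{s,t} = y'_s W_{s,t} + R_{s,t}. *)
Lemma controlled_bound_incr Y c : controlled_bound Y c ->
  forall s t, 0 <= s <= T -> 0 <= t <= T ->
  `|incr Y.1 s t| <= c * (w + T `^ alpha) * `|t - s| `^ alpha.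
Proof.
move=> Yc s t sT tT; have c0 := controlled_bound_ge0 Yc.
have [_ Y2c _ Yr] := Yc; rewrite incr_remainder.
have H1 : `|Y.2 s (incr W s t)| <= c * (w * `|t - s| `^ alpha).
  by rewrite (le_trans (ler_hom_norm _ _))// ler_pM// ?Y2c ?W_holder.
have H2 : `|remainder W Y s t| <= c * (T `^ alpha * `|t - s| `^ alpha).
  rewrite (le_trans (Yr s t sT tT))// ler_wpM2l// powR_double_alpha.
  by rewrite ler_wpM2r ?powR_ge0// powR_time_le// ltW.
rewrite (le_trans (ler_normD _ _))// (le_trans (lerD H1 H2))//.
by rewrite le_eqVlt; apply/predU1P; left; ring.
Qed.

Lemma holder_norm2_finite (F : normedModType R) gamma (A : R -> R -> F) c :
  (forall s t, 0 <= s <= T -> 0 <= t <= T ->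
    `|A s t| <= c * `|t - s| `^ gamma) ->
  (holder_norm2 gamma T A < +oo)%E.
Proof.
move=> Ac; apply: (@le_lt_trans _ _ c%:E); last exact: ltry.
by apply/holder_norm2_leP => s t sT tT _; exact: Ac.
Qed.

Lemma controlled_bound_controlled Y c :
  controlled_bound Y c -> controlled alpha T W Y.
Proof.
move=> Yc; have [_ _ Y2h Yr] := Yc; split; [|exact: holder_norm2_finite Y2h|].
  exact: holder_norm2_finite (controlled_bound_incr Yc).
exact: holder_norm2_finite Yr.
Qed.

Lemma controlled_norm_le Y c :
  controlled_bound Y c -> (controlled_norm alpha T W Y <= (4 * c)%:E)%E.
Proof.
move=> [Y1c Y2c Y2h Yr].
have -> : (4 * c)%:E = (c%:E + c%:E + c%:E + c%:E)%E.
  by rewrite -!EFinD; congr _%:E; ring.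
rewrite /controlled_norm !leeD//; first exact/sup_norm_leP.
- exact/sup_norm_leP.
- by apply/holder_norm2_leP => s t sT tT _; exact: Y2h.
- by apply/holder_norm2_leP => s t sT tT _; exact: Yr.
Qed.

(** The Hölder seminorms quantify over s != t; for the functions at hand the
    bound extends to the diagonal, which spares later case distinctions. *)
Lemma le_holder_diag (F : normedModType R) gamma (A : R -> R -> F) c :
  0 <= c -> (forall s, 0 <= s <= T -> A s s = 0) ->
  (forall s t, 0 <= s <= T -> 0 <= t <= T -> s != t ->
    `|A s t| <= c * `|t - s| `^ gamma) ->
  forall s t, 0 <= s <= T -> 0 <= t <= T -> `|A s t| <= c * `|t - s| `^ gamma.
Proof.
move=> c0 A0 Ac s t sT tT; have [->|st] := eqVneq s t; last exact: Ac.
by rewrite A0// normr0 mulr_ge0// powR_ge0.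
Qed.

Lemma incr_diag (F : normedModType R) (Z : R -> F) s : incr Z s s = 0.
Proof. exact: subrr. Qed.

Lemma remainder_diag Y s : remainder W Y s s = 0.
Proof. by rewrite /remainder !incr_diag linear0 subrr. Qed.

Lemma controlled_norm_bound Y c :
  (controlled_norm alpha T W Y <= c%:E)%E -> controlled_bound Y c.
Proof.
rewrite /controlled_norm => H.
have p1 := @sup_norm_ge0 _ _ T Y.1 T_gt0.
have p2 := @sup_norm_ge0 _ _ T Y.2 T_gt0.
have p3 := @holder_norm2_ge0 _ _ alpha T (incr Y.2) T_gt0.
have p4 := @holder_norm2_ge0 _ _ (2 * alpha) T (remainder W Y) T_gt0.
have c0 : 0 <= c by rewrite -lee_fin (le_trans _ H)// !adde_ge0.
split.
- apply/sup_norm_leP; rewrite (le_trans _ H)// -!addeA leeDl// !adde_ge0//.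
- apply/sup_norm_leP; rewrite (le_trans _ H)// -!addeA.
  by rewrite (le_trans _ (leeDr _ p1))// leeDl// adde_ge0.
- apply: le_holder_diag => //; first by move=> *; exact: incr_diag.
  apply/holder_norm2_leP; rewrite (le_trans _ H)// addeAC leeDr//.
  by rewrite !adde_ge0.
- apply: le_holder_diag => //; first by move=> *; exact: remainder_diag.
  by apply/holder_norm2_leP; rewrite (le_trans _ H)// leeDr// !adde_ge0.
Qed.

Lemma sup_norm_finite (F : normedModType R) (Z : R -> F) :
  (holder_norm alpha T Z < +oo)%E -> exists2 c, 0 <= c &
    forall t, 0 <= t <= T -> `|Z t| <= c.
Proof.
move=> /holder_norm2_lty[c c0 Zc].
exists (`|Z 0| + c * T `^ alpha).
  by rewrite addr_ge0// mulr_ge0// powR_ge0.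
have T0 : 0 <= (0 : R) <= T by rewrite lexx ltW.
move=> t tT; rewrite -[Z t](subrK (Z 0)) addrC (le_trans (ler_normD _ _))//.
rewrite lerD2l (le_trans (le_holder_diag c0 _ Zc _ _))//.
  by move=> ? _; exact: incr_diag.
by rewrite ler_wpM2l// powR_time_le// ltW.
Qed.

Lemma controlled_boundP Y :
  controlled alpha T W Y -> exists c, controlled_bound Y c.
Proof.
move=> [Y1h Y2h Yr].
have [c1 c10 H1] := sup_norm_finite Y1h.
have [c2 c20 H2] := sup_norm_finite Y2h.
have [c3 c30 H3] := holder_norm2_lty Y2h.
have [c4 c40 H4] := holder_norm2_lty Yr.
exists (c1 + c2 + c3 + c4); split=> [t tT|t tT||].
- by have := H1 t tT; lra.
- by have := H2 t tT; lra.
- apply: le_holder_diag; [lra|by move=> *; exact: incr_diag|].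
  move=> s t sT tT st.
  rewrite (le_trans (H3 s t sT tT st))// ler_wpM2r ?powR_ge0//; lra.
- apply: le_holder_diag; [lra|by move=> *; exact: remainder_diag|].
  move=> s t sT tT st.
  rewrite (le_trans (H4 s t sT tT st))// ler_wpM2r ?powR_ge0//; lra.
Qed.

End fixed_space.
End controlled_bound.
(** * The rough integral *)

(** Joins the complete and the normed structures of column vectors. *)
HB.instance Definition _ (R : realType) (d : nat) := NormedModule.on 'cV[R]_d.

Section rough_integral_bounds.
Context {R : realType} {n d : nat}.
Variables (T alpha w : R) (W : R -> 'cV[R]_n) (WW : R -> R -> 'M[R]_n).
Hypotheses (T_gt0 : 0 < T) (alpha_gt : 1 / 3 < alpha) (w_ge0 : 0 <= w).
Hypothesis chen : forall s u t, 0 <= s <= T -> 0 <= u <= T -> 0 <= t <= T ->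
  WW s t - WW s u - WW u t = tensor (incr W s u) (incr W u t).
Hypothesis W_holder : forall s t, 0 <= s <= T -> 0 <= t <= T ->
  `|incr W s t| <= w * `|t - s| `^ alpha.
Hypothesis WW_holder : forall s t, 0 <= s <= T -> 0 <= t <= T ->
  `|WW s t| <= w * `|t - s| `^ (2 * alpha).
Implicit Types (Y Z : path_pair n 'Hom('cV[R]_n, 'cV[R]_d)) (c : R).

Let alpha_gt0 : 0 < alpha. Proof. by move: alpha_gt; lra. Qed.
Let theta_gt1 : 1 < 3 * alpha. Proof. by move: alpha_gt; lra. Qed.

Local Notation bound := (controlled_bound T alpha W).

Lemma rough_germE Y u v :
  rough_germ W WW Y u v = Y.1 u (incr W u v) + tensor_eval (Y.2 u) (WW u v).
Proof. by []. Qed.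

(** Expand everything at s, with y_u = y_s + y'_s W_{s,u} + R_{s,u}. By Chen's
    relation y'_s WW_{s,t} produces y'_s (W_{s,u} (x) W_{u,t}), that is
    (y'_s W_{s,u}) W_{u,t}, which cancels the first-order part of y_u W_{u,t};
    this is what the second-level term of the germ is for. *)
Lemma rough_germ_defect Y s u t :
    0 <= s <= T -> 0 <= u <= T -> 0 <= t <= T ->
  rough_germ W WW Y s t - (rough_germ W WW Y s u + rough_germ W WW Y u t) =
  - (remainder W Y s u (incr W u t) + tensor_eval (incr Y.2 s u) (WW u t)).
Proof.
move=> sT uT tT; rewrite !rough_germE.
have -> : incr W s t = incr W s u + incr W u t.
  by rewrite /incr [RHS]addrC addrA subrK.
have -> : WW s t = WW s u + WW u t + tensor (incr W s u) (incr W u t).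
  rewrite -chen//; apply/matrixP => i j; rewrite !mxE; ring.
have -> : Y.1 u = Y.1 s + (Y.2 s (incr W s u) + remainder W Y s u).
  by rewrite -incr_remainder /incr addrC subrK.
have -> : Y.2 u = Y.2 s + incr Y.2 s u by rewrite /incr addrC subrK.
rewrite !tensor_evalDr tensor_evalDl tensor_eval_tensor linearD/= !add_lfunE.
apply/matrixP => i j; rewrite !mxE; ring.
Qed.

Definition defect_const : R := w * (1 + (n ^ 2)%:R).

Lemma defect_const_ge0 : 0 <= defect_const.
Proof. by rewrite mulr_ge0// addr_ge0// ler0n. Qed.

Lemma rough_germ_almost_additive Y c : bound Y c ->
  forall s u t, 0 <= s -> s <= u -> u <= t -> t <= T ->
  `|rough_germ W WW Y s t - (rough_germ W WW Y s u + rough_germ W WW Y u t)|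
  <= c * defect_const * (t - s) `^ (3 * alpha).
Proof.
move=> Yc s u t s0 su ut tT; have c0 := controlled_bound_ge0 T_gt0 Yc.
have a0 := alpha_gt0; have T0 := T_gt0; have w0 := w_ge0.
have [sT uT tT'] : [/\ 0 <= s <= T, 0 <= u <= T & 0 <= t <= T] by split; lra.
have [_ _ Y2h Yr] := Yc.
rewrite rough_germ_defect// normrN (le_trans (ler_normD _ _))//.
have H1 : `|remainder W Y s u (incr W u t)| <= c * w * (t - s) `^ (3 * alpha).
  rewrite (le_trans (ler_hom_norm _ _))//.
  rewrite (le_trans (ler_pM _ _ (Yr s u sT uT) (W_holder uT tT')))//.
  rewrite mulrACA ler_wpM2l ?mulr_ge0//.
  rewrite !ger0_norm ?subr_ge0//.
  have -> : 3 * alpha = 2 * alpha + alpha by ring.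
  by apply: ler_powR_split; lra.
have H2 : `|tensor_eval (incr Y.2 s u) (WW u t)| <=
    (n ^ 2)%:R * (c * w) * (t - s) `^ (3 * alpha).
  rewrite (le_trans (ler_tensor_eval _ _))// -!mulrA ler_wpM2l ?ler0n//.
  rewrite (le_trans (ler_pM _ _ (Y2h s u sT uT) (WW_holder uT tT')))//.
  rewrite mulrACA [leRHS]mulrA ler_wpM2l ?mulr_ge0//.
  rewrite !ger0_norm ?subr_ge0//.
  have -> : 3 * alpha = alpha + 2 * alpha by ring.
  by apply: ler_powR_split; lra.
rewrite (le_trans (lerD H1 H2))// le_eqVlt; apply/predU1P; left.
by rewrite /defect_const; ring.
Qed.

Lemma cvg_rough_sum Y c : bound Y c ->
  forall s t, 0 <= s -> s <= t -> t <= T ->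
  cvg (rough_sum W WW Y s p @[p --> mesh0 s t]).
Proof.
move=> Yc s t s0 st tT; have c0 := controlled_bound_ge0 T_gt0 Yc.
have a0 := alpha_gt0; have T0 := T_gt0; have w0 := w_ge0.
exact: (cvg_sewing theta_gt1 (mulr_ge0 c0 defect_const_ge0)
  (rough_germ_almost_additive Yc)).
Qed.

Definition local_const : R := defect_const * sewing_const (3 * alpha).

Lemma local_const_ge0 : 0 <= local_const.
Proof. by rewrite mulr_ge0 ?defect_const_ge0 ?sewing_const_ge0. Qed.

Lemma rough_integral_local Y c : bound Y c ->
  forall s t, 0 <= s -> s <= t -> t <= T ->
  `|rough_integral W WW Y s t - rough_germ W WW Y s t|
  <= c * local_const * (t - s) `^ (3 * alpha).
Proof.
move=> Yc s t s0 st tT; have c0 := controlled_bound_ge0 T_gt0 Yc.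
have a0 := alpha_gt0; have T0 := T_gt0; have w0 := w_ge0.
rewrite /local_const mulrA.
exact: (sewing_local theta_gt1 (mulr_ge0 c0 defect_const_ge0)
  (rough_germ_almost_additive Yc)).
Qed.

Lemma rough_integral_incr Y c : bound Y c ->
  forall s t, 0 <= s -> s <= t -> t <= T ->
  incr (rough_integral W WW Y 0) s t = rough_integral W WW Y s t.
Proof.
move=> Yc s t s0 st tT; have c0 := controlled_bound_ge0 T_gt0 Yc.
have a0 := alpha_gt0; have T0 := T_gt0; have w0 := w_ge0.
have := sewing_additive theta_gt1 (mulr_ge0 c0 defect_const_ge0)
  (rough_germ_almost_additive Yc) (lexx 0) s0 st tT.
by rewrite /incr /rough_integral /sewing => ->; rewrite addrAC addrN add0r.
Qed.

Lemma rough_integral_sup Y c : bound Y c -> forall t, 0 <= t <= T ->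
  `|rough_integral W WW Y 0 t| <=
  c * (w * T `^ alpha + (n ^ 2)%:R * (w * T `^ (2 * alpha)) +
       local_const * T `^ (3 * alpha)).
Proof.
move=> Yc t tT; have c0 := controlled_bound_ge0 T_gt0 Yc.
have a0 := alpha_gt0; have T0 := T_gt0; have w0 := w_ge0.
have [Y1c Y2c _ _] := Yc; have [t0 t1] := andP tT.
have O0 : 0 <= (0 : R) <= T by rewrite lexx ltW.
have I := rough_integral_local Yc (lexx 0) t0 t1.
have germ1 : `|Y.1 0 (incr W 0 t)| <= c * (w * T `^ alpha).
  rewrite (le_trans (ler_hom_norm _ _))// ler_pM// ?Y1c//.
  rewrite (le_trans (W_holder _ _))// ler_wpM2l//.
  by apply: powR_time_le => //; exact: ltW.
have germ2 : `|tensor_eval (Y.2 0) (WW 0 t)| <=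
    (n ^ 2)%:R * (c * (w * T `^ (2 * alpha))).
  rewrite (le_trans (ler_tensor_eval _ _))// -mulrA ler_wpM2l ?ler0n//.
  rewrite ler_pM ?Y2c// (le_trans (WW_holder _ _))// ler_wpM2l//.
  by apply: powR_time_le => //; lra.
have tail : c * local_const * (t - 0) `^ (3 * alpha) <=
    c * local_const * T `^ (3 * alpha).
  apply: ler_wpM2l; first by rewrite mulr_ge0// local_const_ge0.
  by rewrite subr0 ler_powR2r//; lra.
rewrite -[rough_integral _ _ _ _ _](subrK (rough_germ W WW Y 0 t)).
rewrite (le_trans (ler_normD _ _))// [in X in _ + X <= _]rough_germE.
have := ler_normD (Y.1 0 (incr W 0 t)) (tensor_eval (Y.2 0) (WW 0 t)).
rewrite -/(incr _ _ _); nra.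
Qed.

(** The remainder is y'_s WW_{s,t} plus the sewing error of order 3 alpha; one
    factor |t-s|^alpha of the latter is absorbed into T^alpha. *)
Lemma rough_integral_remainder_forward Y c : bound Y c ->
  forall s t, 0 <= s -> s <= t -> t <= T ->
  `|remainder W (rough_integral_map W WW Y) s t| <=
  c * ((n ^ 2)%:R * w + local_const * T `^ alpha) * (t - s) `^ (2 * alpha).
Proof.
move=> Yc s t s0 st tT; have c0 := controlled_bound_ge0 T_gt0 Yc.
have a0 := alpha_gt0; have T0 := T_gt0; have w0 := w_ge0.
have [sT tT'] : 0 <= s <= T /\ 0 <= t <= T by split; lra.
have [_ Y2c _ _] := Yc; have I := rough_integral_local Yc s0 st tT.
have -> : remainder W (rough_integral_map W WW Y) s t =
    (rough_integral W WW Y s t - rough_germ W WW Y s t)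
    + tensor_eval (Y.2 s) (WW s t).
  rewrite /remainder /= (rough_integral_incr Yc)// rough_germE opprD addrA.
  by rewrite subrK.
rewrite (le_trans (ler_normD _ _))//.
have H1 : c * local_const * (t - s) `^ (3 * alpha) <=
    c * local_const * (T `^ alpha * (t - s) `^ (2 * alpha)).
  apply: ler_wpM2l; first by rewrite mulr_ge0// local_const_ge0.
  have -> : 3 * alpha = alpha + 2 * alpha by ring.
  rewrite powRD; last by rewrite gt_eqF//; lra.
  rewrite ler_wpM2r ?powR_ge0//; apply: ler_powR2r; lra.
have H2 : `|tensor_eval (Y.2 s) (WW s t)| <=
    (n ^ 2)%:R * (c * (w * (t - s) `^ (2 * alpha))).
  rewrite (le_trans (ler_tensor_eval _ _))// -mulrA ler_wpM2l ?ler0n//.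
  rewrite ler_pM ?Y2c// (le_trans (WW_holder _ _))//.
  by rewrite ger0_norm// subr_ge0.
rewrite (le_trans (lerD (le_trans I H1) H2))// le_eqVlt; apply/predU1P; left.
by ring.
Qed.

(** Sewing controls the remainder only for s <= t. Exchanging the two times
    re-expands at the other end point and costs a product of two increments,
    again of order 2 alpha. *)
Lemma remainder_swap {E : finNormedModType R} (X : path_pair n E) s t :
  remainder W X s t = - remainder W X t s + incr X.2 s t (incr W s t).
Proof.
have incrN (F : zmodType) (f : R -> F) : f s - f t = - (f t - f s).
  by rewrite opprB.
rewrite /remainder /incr (incrN _ X.1) (incrN _ W) linearN.
by rewrite add_lfunE opp_lfunE opprD !opprK addrA subrK.
Qed.

(** The sum of the constants of the four bounds that make up controlled_bound:
    the supremum of the integral, the supremum and the Hölder norm of y, now in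
    the role of derivative, and the remainder. *)
Definition integral_const : R :=
  w * T `^ alpha + (n ^ 2)%:R * (w * T `^ (2 * alpha)) +
    local_const * T `^ (3 * alpha)
  + 1 + (w + T `^ alpha)
  + ((n ^ 2)%:R * w + local_const * T `^ alpha + (w + T `^ alpha) * w).

(** The constant does not depend on Y: (y,y') |-> (int y dW, y) is a bounded
    map. *)
Lemma rough_integral_bound Y c :
  bound Y c -> bound (rough_integral_map W WW Y) (c * integral_const).
Proof.
move=> Yc; have c0 := controlled_bound_ge0 T_gt0 Yc.
have a0 := alpha_gt0; have T0 := T_gt0; have w0 := w_ge0.
have l0 := local_const_ge0; have N0 : 0 <= (n ^ 2)%:R :> R by rewrite ler0n.
have k1 : 0 <= w * T `^ alpha by rewrite mulr_ge0 ?powR_ge0.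
have k2 : 0 <= (n ^ 2)%:R * (w * T `^ (2 * alpha)).
  by rewrite !mulr_ge0 ?powR_ge0.
have k3 : 0 <= local_const * T `^ (3 * alpha) by rewrite mulr_ge0 ?powR_ge0.
have k4 : 0 <= T `^ alpha by rewrite powR_ge0.
have k5 : 0 <= (n ^ 2)%:R * w by rewrite mulr_ge0.
have k6 : 0 <= local_const * T `^ alpha by rewrite mulr_ge0.
have k7 : 0 <= (w + T `^ alpha) * w by rewrite mulr_ge0// addr_ge0.
have Y1h := controlled_bound_incr T_gt0 alpha_gt0 W_holder Yc.
split=> [t tT|t tT|s t sT tT|s t sT tT].
- rewrite (le_trans (rough_integral_sup Yc tT))// ler_wpM2l//.
  by rewrite /integral_const; lra.
- have [Y1c _ _ _] := Yc; rewrite (le_trans (Y1c t tT))//.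
  by rewrite ler_peMr// /integral_const; lra.
- rewrite (le_trans (Y1h s t sT tT))//.
  by rewrite ler_wpM2r ?powR_ge0// ler_wpM2l// /integral_const; lra.
have tight : forall s t, 0 <= s <= T -> 0 <= t <= T ->
    `|remainder W (rough_integral_map W WW Y) s t| <=
  c * ((n ^ 2)%:R * w + local_const * T `^ alpha + (w + T `^ alpha) * w) *
  `|t - s| `^ (2 * alpha).
  move=> {sT tT}s {}t sT tT; have [s0 s1] := andP sT; have [t0 t1] := andP tT.
  have [st|/ltW ts] := leP s t.
    rewrite (le_trans (rough_integral_remainder_forward Yc _ _ _))//.
    rewrite ger0_norm ?subr_ge0// ler_wpM2r ?powR_ge0// ler_wpM2l//; lra.
  have H1 := rough_integral_remainder_forward Yc t0 ts s1.
  have H2 : `|incr Y.1 s t (incr W s t)| <=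
      c * (w + T `^ alpha) * w * `|t - s| `^ (2 * alpha).
    rewrite (le_trans (ler_hom_norm _ _))//.
    rewrite (le_trans (ler_pM _ _ (Y1h s t sT tT) (W_holder sT tT)))//.
    by rewrite mulrACA -powR_double_alpha.
  rewrite remainder_swap (le_trans (ler_normD _ _))// normrN.
  rewrite (le_trans (lerD H1 H2))// distrC ger0_norm ?subr_ge0//.
  by rewrite le_eqVlt; apply/predU1P; left; ring.
rewrite (le_trans (tight s t sT tT))// ler_wpM2r ?powR_ge0// ler_wpM2l//.
by rewrite /integral_const; lra.
Qed.

Lemma rough_integralB Y Z cY cZ : bound Y cY -> bound Z cZ ->
  forall s t, 0 <= s -> s <= t -> t <= T ->
  rough_integral W WW (Z - Y) s t =
  rough_integral W WW Z s t - rough_integral W WW Y s t.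
Proof.
move=> Yc Zc s t s0 st tT; have FF := mesh0_proper st.
apply: cvg_lim => //.
have -> : rough_sum W WW (Z - Y) s =
    rough_sum W WW Z s \- rough_sum W WW Y s.
  apply/funext => p /=; rewrite /rough_sum -sumrB; apply: eq_bigr => uv _.
  rewrite !rough_germE /= add_lfunE opp_lfunE tensor_evalDl tensor_evalNl.
  by rewrite opprD addrACA.
by apply: cvgB; [exact: (cvg_rough_sum Zc)|exact: (cvg_rough_sum Yc)].
Qed.

(** By linearity, continuity at Y is the bound applied to Z - Y. *)
Lemma rough_integral_map_continuous :
  controlled_continuous alpha T W (@rough_integral_map R n d W WW).
Proof.
move=> Y /(controlled_boundP T_gt0 alpha_gt0)[cY Yc] e e0.
set M := integral_const; have M1 : 0 < `|M| + 1 by rewrite ltr_wpDl.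
(* The 4 is that of controlled_norm_le; `|M| + 1 is positive and above M. *)
exists (e / (4 * (`|M| + 1))); first by rewrite divr_gt0// mulr_gt0.
move=> Z /(controlled_boundP T_gt0 alpha_gt0)[cZ Zc] /ltW.
move=> /(controlled_norm_bound T_gt0)/rough_integral_bound; rewrite -/M => ZYc.
apply: (@le_lt_trans _ _ (4 * (e / (4 * (`|M| + 1)) * M))%:E).
  apply: controlled_norm_le; apply: controlled_bound_eq ZYc => t tT.
  split => //=; have [t0 t1] := andP tT.
  exact: (rough_integralB Yc Zc).
rewrite lte_fin (_ : _ * _ = e * M / (`|M| + 1)); last by field; lra.
rewrite ltr_pdivrMr// ltr_pM2l//.
by have := ler_norm M; lra.
Qed.

End rough_integral_bounds.
(** One constant for both levels. On the diagonal WW vanishes by Chen's relation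
    at s = u = t. *)
Lemma rough_path_bound (R : realType) (n : nat) (alpha T : R)
    (W : R -> 'cV[R]_n) (WW : R -> R -> 'M[R]_n) : 0 < T ->
  rough_path alpha T W WW -> exists w, [/\ 0 <= w,
    forall s u t, 0 <= s <= T -> 0 <= u <= T -> 0 <= t <= T ->
      WW s t - WW s u - WW u t = tensor (incr W s u) (incr W u t),
    forall s t, 0 <= s <= T -> 0 <= t <= T ->
      `|incr W s t| <= w * `|t - s| `^ alpha
  & forall s t, 0 <= s <= T -> 0 <= t <= T ->
      `|WW s t| <= w * `|t - s| `^ (2 * alpha)].
Proof.
move=> T0 [chen /holder_norm2_lty[w1 w10 H1] /holder_norm2_lty[w2 w20 H2]].
have chenT s u t : 0 <= s <= T -> 0 <= u <= T -> 0 <= t <= T ->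
    WW s t - WW s u - WW u t = tensor (incr W s u) (incr W u t).
  by move=> sT uT tT; apply: chen; rewrite in_itv.
have WW0 s : 0 <= s <= T -> WW s s = 0.
  move=> sT; have := chenT s s s sT sT sT; rewrite subrr sub0r incr_diag.
  rewrite /tensor mul0mx => /eqP; rewrite oppr_eq0.
  by move/eqP.
have w0 : 0 <= w1 + w2 by rewrite addr_ge0.
exists (w1 + w2); split=> //; apply: le_holder_diag => //.
- by move=> s _; exact: incr_diag.
- move=> s t sT tT st; rewrite (le_trans (H1 s t sT tT st))//.
  by rewrite ler_wpM2r ?powR_ge0// lerDl.
- move=> s t sT tT st; rewrite (le_trans (H2 s t sT tT st))//.
  by rewrite ler_wpM2r ?powR_ge0// lerDr.
Qed.

Theorem theorem4p15 (R : realType) (n d : nat) (T alpha : R)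
    (W : R -> 'cV[R]_n) (WW : R -> R -> 'M[R]_n)
    (T_gt0 : 0 < T) (alpha_gt : 1 / 3 < alpha) (alpha_le : alpha <= 1 / 2)
    (hW : rough_path alpha T W WW) :
  [/\ forall Y : path_pair n 'Hom('cV[R]_n, 'cV[R]_d),
        controlled alpha T W Y ->
        forall s t : R, 0 <= s -> s <= t -> t <= T ->
        cvg (rough_sum W WW Y s p @[p --> mesh0 s t]),
      forall Y : path_pair n 'Hom('cV[R]_n, 'cV[R]_d),
        controlled alpha T W Y ->
        controlled alpha T W (rough_integral_map W WW Y)
    & controlled_continuous alpha T W
        (@rough_integral_map R n d W WW)].
Proof.
have alpha_gt0 : 0 < alpha by lra.
have [w [w0 chen W_holder WW_holder]] := rough_path_bound T_gt0 hW.
split.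
- move=> Y /(controlled_boundP T_gt0 alpha_gt0)[c Yc].
  exact: (cvg_rough_sum T_gt0 alpha_gt w0 chen W_holder WW_holder Yc).
- move=> Y /(controlled_boundP T_gt0 alpha_gt0)[c Yc].
  apply: (controlled_bound_controlled T_gt0 alpha_gt0 W_holder).
  exact: (rough_integral_bound T_gt0 alpha_gt w0 chen W_holder WW_holder Yc).
- exact: (rough_integral_map_continuous T_gt0 alpha_gt w0 chen W_holder
    WW_holder).
Qed.
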